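(* There exists a tournament $R$ with $\operatorname{inv}(R)=\operatorname{inv}(\vec{C_3}\rightarrow R)=3$.
   Context: All digraphs are oriented graphs: directed graphs without loops, digons (pairs of opposite edges) or parallel edges. For a digraph $D$ and $X\subseteq V(D)$, the inversion of $X$ in $D$ is the digraph obtained from $D$ by reversing the direction of every edge with both endpoints in $X$. A family $X_1,\dots,X_k\subseteq V(D)$ is a decycling family of $D$ if inverting $X_1,\dots,X_k$ in turn transforms $D$ into an acyclic digraph (the result does not depend on the order). The inversion number $\operatorname{inv}(D)$ is the minimum size of a decycling family of $D$. $\vec{C_3}$ is the directed cycle on three vertices. For oriented graphs $L,R$, the dijoin $L\rightarrow R$ is the oriented graph consisting of vertex-disjoint copies of $L$ and $R$ together with an edge $\vec{uv}$ for every $u\in V(L)$ and $v\in V(R)$. *)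

(* Defs.v *)
From mathcomp Require Import all_boot.

Set Implicit Arguments.
Unset Strict Implicit.
Unset Printing Implicit Defensive.

(* Parallel edges are excluded by representing edges as a relation. *)
Record ograph (V : finType) := OGraph {
  arc :> rel V;
  arc_loopless : irreflexive arc;
  arc_nodigon : forall x y, arc x y -> ~~ arc y x }.

Definition tournament (V : finType) (D : ograph V) : Prop :=
  forall x y : V, x != y -> D x y || D y x.

Section Inversion.

Variable V : finType.
Implicit Types (D : ograph V) (X : {set V}).

Definition invert_arc D X : rel V :=
  fun x y => if (x \in X) && (y \in X) then D y x else D x y.

Lemma invert_loopless D X : irreflexive (invert_arc D X).
Proof. by move=> x; rewrite /invert_arc !arc_loopless if_same. Qed.

Lemma invert_nodigon D X x y : invert_arc D X x y -> ~~ invert_arc D X y x.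
Proof.
by rewrite /invert_arc [(y \in X) && _]andbC; case: ifP => _; apply: arc_nodigon.
Qed.

Definition invert D X : ograph V :=
  OGraph (@invert_loopless D X) (@invert_nodigon D X).

Definition invert_family D (Xs : seq {set V}) : ograph V := foldl invert D Xs.

(* [ucycle] asks for pairwise distinct vertices, but also accepts the empty
   sequence, which is not a directed cycle. *)
Definition acyclic D : Prop := forall c : seq V, ucycle D c -> c = [::].

Definition acyclicb D : bool :=
  [forall n : 'I_#|V|, forall c : n.+1.-tuple V, ~~ ucycleb D c].

Lemma acyclicP D : reflect (acyclic D) (acyclicb D).
Proof.
apply: (iffP forallP) => [noC [//|x p] xpC | acD n].
  have lt_p : size p < #|V|.
    have /andP[_ /card_uniqP/= <-] := xpC; exact: max_card.
  by have /forallP/(_ (in_tuple (x :: p)))/negP := noC (Ordinal lt_p).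
apply/forallP=> c; apply/negP=> /acD c0.
by have := size_tuple c; rewrite c0.
Qed.

Definition decycling D (Xs : seq {set V}) : Prop := acyclic (invert_family D Xs).

Definition has_decycling D (k : nat) : bool :=
  [exists Xs : k.-tuple {set V}, acyclicb (invert_family D Xs)].

Lemma has_decyclingP D k :
  reflect (exists2 Xs, size Xs = k & decycling D Xs) (has_decycling D k).
Proof.
apply: (iffP existsP) => [[Xs /acyclicP acXs] | [Xs <- /acyclicP acXs]].
  by exists Xs; rewrite ?size_tuple.
by exists (in_tuple Xs).
Qed.

(* Arcs that decrease the enumeration rank are reversed one at a time, by
   inverting the pairs of their endpoints. *)
Let back D := [set p : V * V | D p.1 p.2 & enum_rank p.2 < enum_rank p.1].

Lemma back0_acyclic D : back D = set0 -> acyclic D.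
Proof.
move=> D0 [//|x p] /andP[/= xpC _].
have fwd u v : D u v -> enum_rank u < enum_rank v.
  move=> Duv; rewrite ltnNge leq_eqVlt; apply/negP=> /predU1P[|vu].
    by move=> /val_inj/enum_rank_inj vu; rewrite vu arc_loopless in Duv.
  by have := in_set0 (u, v); rewrite -D0 inE /= Duv vu.
have fwdp z q : path D z q -> enum_rank z <= enum_rank (last z q).
  elim: q z => //= y q IHq z /andP[/fwd zy /IHq]; exact/leq_trans/ltnW.
move: xpC; rewrite rcons_path => /andP[/fwdp le_xp /fwd].
by rewrite ltnNge le_xp.
Qed.

Lemma ex_decycling D : exists k, has_decycling D k.
Proof.
have [m] := ubnP #|back D|; elim: m D => // m IHm D; rewrite ltnS => leDm.
have [D0 | [[u v] uvD]] := set_0Vmem (back D).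
  exists 0; apply/has_decyclingP; exists [::] => //; exact: back0_acyclic.
have [|k /has_decyclingP[Xs szXs decXs]] := IHm (invert D [set u; v]).
  apply: leq_trans leDm; apply/proper_card/properP; split; last first.
    exists (u, v) => //; move: uvD; rewrite !inE /= => /andP[/arc_nodigon Dvu _].
    by rewrite /invert_arc !inE !eqxx orbT /= (negPf Dvu).
  apply/subsetP=> -[x y]; move: uvD; rewrite !inE /= => /andP[Duv vu].
  rewrite /invert_arc !inE; case: ifP => // /andP[] /orP[]/eqP-> /orP[]/eqP->;
    by rewrite ?arc_loopless // Duv // ltnNge ltnW.
by exists k.+1; apply/has_decyclingP; exists ([set u; v] :: Xs); rewrite /= ?szXs.
Qed.

Definition inversion_number D : nat := ex_minn (ex_decycling D).

Lemma inversion_numberP D k :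
  inversion_number D = k <-> (exists2 Xs, size Xs = k & decycling D Xs) /\
                (forall Xs, decycling D Xs -> k <= size Xs).
Proof.
rewrite /inversion_number; case: ex_minnP => m /has_decyclingP[Ys szYs decYs] minm.
have {}minm Xs : decycling D Xs -> m <= size Xs.
  by move=> decXs; apply: minm; apply/has_decyclingP; exists Xs.
split=> [<- | [[Xs szXs /minm le_mX] mink]]; first by split=> //; exists Ys.
by apply/eqP; rewrite eqn_leq -{1}szXs le_mX -szYs mink.
Qed.

End Inversion.

Section DirectedTriangle.

Definition C3_arc : rel 'I_3 := fun i j => j == ordS i.

Lemma C3_loopless : irreflexive C3_arc.
Proof. by case=> [[|[|[|//]]] ?]. Qed.

Lemma C3_nodigon i j : C3_arc i j -> ~~ C3_arc j i.
Proof. by case: i => [[|[|[|//]]] ?]; case: j => [[|[|[|//]]] ?]. Qed.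

Definition C3 : ograph 'I_3 := OGraph C3_loopless C3_nodigon.

End DirectedTriangle.

Section Dijoin.

Variables (U V : finType) (L : ograph U) (R : ograph V).

Definition dijoin_arc : rel (U + V) := fun x y =>
  match x, y with
  | inl u, inl u' => L u u'
  | inr v, inr v' => R v v'
  | inl _, inr _ => true
  | inr _, inl _ => false
  end.

Lemma dijoin_loopless : irreflexive dijoin_arc.
Proof. by case=> x /=; apply: arc_loopless. Qed.

Lemma dijoin_nodigon x y : dijoin_arc x y -> ~~ dijoin_arc y x.
Proof. by case: x y => [x|x] [y|y] //=; apply: arc_nodigon. Qed.

Definition dijoin : ograph (U + V)%type := OGraph dijoin_loopless dijoin_nodigon.

End Dijoin.

(* Main.v *)
Require Import Defs.
From mathcomp Require Import all_boot.

Set Implicit Arguments.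
Unset Strict Implicit.
Unset Printing Implicit Defensive.

(** Give each vertex the vector of its memberships in the inverted sets: an arc
is reversed iff its endpoints have odd scalar product. Let [R] be obtained from
a transitive tournament, whose vertices are coloured 0, 1 or 2, by reversing the
arcs between colours 1 and 2; the vectors 000, 110, 101 for the three colours
decycle [R]. These vectors are all orthogonal to 111, which has odd square, so
giving 111, 000, 111 to the vertices of the directed triangle makes it
transitive without affecting any arc from it to [R]. For the colour word
10202121, an exhaustive search shows that no vectors of length 2 decycle [R], nor
hence any oriented graph containing [R]. *)

Lemma acyclic_rank (V : finType) (D : ograph V) (f : V -> nat) :
  (forall u v, D u v -> f u < f v) -> acyclic D.
Proof.
move=> fwd [//|x p] /andP[/= xpC _].
have {}xpC : path (relpre f ltn) x (rcons p x) by apply: sub_path xpC.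
have := order_path_min (fun y x z => @ltn_trans (f y) (f x) (f z)) xpC.
by rewrite all_rcons /= ltnn.
Qed.

Lemma invert_familyE (V : finType) (D : ograph V) Xs u v :
  invert_family D Xs u v =
  if odd (count (fun X : {set V} => (u \in X) && (v \in X)) Xs)
  then D v u else D u v.
Proof.
elim: Xs D => //= X Xs IHXs D; rewrite IHXs /= /invert_arc oddD oddb.
by rewrite [(v \in X) && _]andbC; case: (_ && _); case: (odd _).
Qed.

(** A directed cycle left in [D] would be carried by [h] to one left in [E]; so families restrict to
    induced subdigraphs. *)
Lemma decycling_preim (U V : finType) (D : ograph U) (E : ograph V)
    (h : U -> V) Xs :
    injective h -> (forall x y, E (h x) (h y) = D x y) ->
  decycling E Xs -> decycling D [seq h @^-1: X | X : {set V} <- Xs].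
Proof.
move=> inj_h hE acE c /andP[cC Uc].
suff /acE: ucycle (invert_family E Xs) (map h c) by case: c {cC Uc}.
rewrite /ucycle map_inj_uniq // Uc andbT cycle_map; apply: sub_cycle cC => x y.
rewrite /= !invert_familyE count_map !hE.
by under eq_count => X do rewrite /= !inE.
Qed.

Definition dot2 (p q : bool * bool) := (p.1 && q.1) (+) (p.2 && q.2).

(** Families of fewer than two sets are padded with [set0], which adds 0 to every scalar product. *)
Lemma odd_count_dot2 (V : finType) (Xs : seq {set V}) u v :
  size Xs <= 2 ->
  odd (count (fun X : {set V} => (u \in X) && (v \in X)) Xs) =
  dot2 (u \in nth set0 Xs 0, u \in nth set0 Xs 1)
       (v \in nth set0 Xs 0, v \in nth set0 Xs 1).
Proof.
by case: Xs => [|X [|Y []]] //= _;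
  rewrite /dot2 /= ?in_set0 ?addn0 ?oddD ?oddb ?addbF.
Qed.

Section Search.

Variable r : rel nat.

Definition triangle (e : rel nat) i j k :=
  uniq [:: i; j; k] && cycle e [:: i; j; k].

(** Triangles among earlier vertices are sought when those are appended, so only triangles through
    the last one matter. *)
Definition last_triangle (s : seq (bool * bool)) :=
  let n := (size s).-1 in
  let e i j := r i j (+) dot2 (nth (false, false) s i) (nth (false, false) s j) in
  has (fun i => has (triangle e n i) (iota 0 n)) (iota 0 n).

(* [s] lists the vectors of the vertices [0, ..., size s - 1]; the search tries
   all vectors for the next [m] vertices. The [if] stops [vm_compute], which
   evaluates both arguments of [||], from searching beyond a triangle. *)
Fixpoint forces_triangle m s :=
  if last_triangle s then true else
  if m is m'.+1 then
    all (fun p => forces_triangle m' (rcons s p))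
      [:: (false, false); (false, true); (true, false); (true, true)]
  else false.

Lemma forces_triangleP m n (f : nat -> bool * bool) :
    forces_triangle m (mkseq f n) ->
  exists i j k, all (gtn (n + m)) [:: i; j; k] &&
    triangle (fun i j => r i j (+) dot2 (f i) (f j)) i j k.
Proof.
have lastP n1 : last_triangle (mkseq f n1) ->
    exists i j k, all (gtn n1) [:: i; j; k] &&
    triangle (fun i j => r i j (+) dot2 (f i) (f j)) i j k.
  case: n1 => // n1; rewrite /last_triangle size_mkseq succnK.
  case/hasP=> i; rewrite mem_iota add0n => /andP[_ lt_in].
  case/hasP=> j; rewrite mem_iota add0n => /andP[_ lt_jn].
  have [lt_i lt_j] := (leqW lt_in, leqW lt_jn).
  rewrite /triangle /cycle /rcons /path !nth_mkseq // => tr.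
  by exists n1, i, j; rewrite [all _ _]/= lt_i lt_j ltnSn.
elim: m n => [|m IHm] n /=.
  by case: ifP => // /lastP; rewrite addn0.
case: ifP => [/lastP[i [j [k /andP[lt_n tr]]]] _ | _ /and5P[]]; last first.
  (* [f n] is among the four vectors tried, so the search has a branch following [f]. *)
  by rewrite addnS -addSn => *; apply: IHm; rewrite mkseqS; case: (f n) => [[] []].
exists i, j, k; rewrite tr andbT.
apply: (@sub_all _ _ (gtn _) _ [:: i; j; k]) lt_n => x /=.
by move/leq_trans->; rewrite ?leq_addr.
Qed.

End Search.

Definition colour i := nth 0 [:: 1; 0; 2; 0; 2; 1; 2; 1] i.

(* Colours are at most 2, so their product is 2 iff they are 1 and 2. *)
Definition R_nat i j := (i != j) && ((i < j) (+) (colour i * colour j == 2)).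

Definition R_arc : rel 'I_8 := fun i j => R_nat i j.

Lemma R_loopless : irreflexive R_arc.
Proof. by move=> i; rewrite /R_arc /R_nat eqxx. Qed.

Lemma R_total i j : i != j -> R_nat j i = ~~ R_nat i j.
Proof.
move=> ij; rewrite /R_nat mulnC (eq_sym j) ij.
by rewrite ltn_neqAle (eq_sym j) ij /= leqNgt addNb.
Qed.

Lemma R_nodigon i j : R_arc i j -> ~~ R_arc j i.
Proof. by rewrite /R_arc => Rij; rewrite R_total ?negbK //; case/andP: Rij. Qed.

Definition R8 : ograph 'I_8 := OGraph R_loopless R_nodigon.

Lemma R8_tournament : tournament R8.
Proof. by move=> i j ij; rewrite /= /R_arc (R_total ij) orbN. Qed.

Lemma R8_decycling_size Xs : decycling R8 Xs -> 3 <= size Xs.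
Proof.
move=> acR; rewrite ltnNge; apply/negP=> szXs.
pose f (n : nat) := (inord n \in nth set0 Xs 0, inord n \in nth set0 Xs 1) : bool * bool.
(* [mkseq f 0] is empty, so the computation does not depend on [f]. *)
have [|i [j [k]]] := @forces_triangleP R_nat 8 0 f; first by vm_compute.
rewrite add0n => /andP[lt8 /andP[Uijk Cijk]].
suff /acR : ucycle (invert_family R8 Xs) [seq inord x | x <- [:: i; j; k]] by [].
have [lti ltj ltk _] := and4P lt8.
have RE x y : x < 8 -> y < 8 -> x != y -> R_nat x y (+) dot2 (f x) (f y) ->
    invert_family R8 Xs (inord x) (inord y).
  move=> ltx lty xy; rewrite invert_familyE /= /R_arc !inordK // (R_total xy).
  rewrite odd_count_dot2 // -/(f x) -/(f y).
  by case: (dot2 _ _); rewrite ?addbT ?addbF.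
have Uval : map val [seq inord x : 'I_8 | x <- [:: i; j; k]] = [:: i; j; k].
  by rewrite /= !inordK.
rewrite /ucycle -(map_inj_uniq val_inj) Uval Uijk andbT.
move: Uijk Cijk; rewrite /= !inE !negb_or !andbT => /andP[/andP[ij ik] jk] /and3P[].
by move=> /RE-> // /RE-> // /RE-> //; rewrite eq_sym.
Qed.

Lemma colour_cases i : [|| colour i == 0, colour i == 1 | colour i == 2].
Proof. by do 8?case: i => [//|i]; rewrite /colour /= nth_nil. Qed.

Definition R8_family : seq {set 'I_8} :=
  [:: [set i : 'I_8 | colour i != 0]; [set i : 'I_8 | colour i == 1];
      [set i : 'I_8 | colour i == 2]].

(** The vectors 110 and 101 have even squares and odd scalar product, so exactly the arcs between
    colours 1 and 2 turn back. *)
Lemma R8_family_fwd i j : invert_family R8 R8_family i j -> i < j.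
Proof.
rewrite invert_familyE /= !inE /R_arc /R_nat (mulnC (colour j)) (eq_sym (val j)).
have [/eqP-> | /eqP-> | /eqP->] := or3P (colour_cases i);
have [/eqP-> | /eqP-> | /eqP->] := or3P (colour_cases j);
by rewrite /= ?addbF ?addbT -?leqNgt => /andP[ij] //; rewrite leq_eqVlt (negPf ij).
Qed.

Lemma R8_family_decycling : decycling R8 R8_family.
Proof. exact: acyclic_rank R8_family_fwd. Qed.

(* The ends of the path 0 -> 1 -> 2 of [C3] are added to every set. *)
Definition dijoin_family : seq {set 'I_3 + 'I_8} :=
  [seq [set x : 'I_3 + 'I_8 |
    match x with inl i => i != 1 :> nat | inr j => j \in X end]
    | X : {set 'I_8} <- R8_family].

Lemma dijoin_family_decycling : decycling (dijoin C3 R8) dijoin_family.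
Proof.
pose f (x : 'I_3 + 'I_8) := match x with inl i => i : nat | inr j => 3 + j end.
apply: (@acyclic_rank _ _ f) => -[i|i] [j|j]; rewrite invert_familyE count_map.
- under eq_count => X do rewrite /= !inE.
  by case: i j => [[|[|[|//]]] ?] [[|[|[|//]]] ?].
- by move=> _; rewrite /f; apply: leq_trans (ltn_ord i) (leq_addr _ _).
(* No arc enters the triangle: 1 lies in no set, while 0 and 2 share zero or two sets with each
   vertex of [R8]. *)
- rewrite /= !inE; case: (_ != 1); last by rewrite !andbF.
  by have [/eqP-> | /eqP-> | /eqP->] := or3P (colour_cases i).
- under eq_count => X do rewrite /= !inE.
  by move=> Rij; rewrite ltn_add2l R8_family_fwd ?invert_familyE.
Qed.

Theorem theorem1p2 :
  exists (V : finType) (R : ograph V),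
    tournament R /\ inversion_number R = 3 /\ inversion_number (dijoin C3 R) = 3.
Proof.
exists 'I_8, R8; split; first exact: R8_tournament.
split; apply/inversion_numberP; split.
- by exists R8_family; last exact: R8_family_decycling.
- exact: R8_decycling_size.
- by exists dijoin_family; last exact: dijoin_family_decycling.
move=> Xs /(@decycling_preim _ _ R8 (dijoin C3 R8) inr) acR.
rewrite -(size_map (fun X : {set 'I_3 + 'I_8} => inr @^-1: X)).
by apply/R8_decycling_size/acR => // x y [].
Qed.
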